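(* Let $(\mathscr{X},\|\cdot\|)$ be an inner product space (real or complex). Then for all $p\in[0,1]$ and all nonzero $x,y\in\mathscr{X}$, $$\alpha_{p}[x,y]\leq 2\,\frac {\|x-y\|}{\|x\|^{1-p}+\|y\|^{1-p}}.$$
   Context: For $p\in\mathbb{R}$ and nonzero elements $x,y$ of a normed space $(\mathscr{X},\|\cdot\|)$, the $p$-angular distance is $$\alpha_{p}[x,y]:=\left\|\frac{x}{\|x\|^{1-p}}-\frac{y}{\|y\|^{1-p}}\right\|.$$ Here $\|\cdot\|$ is the norm induced by the inner product $\langle\cdot,\cdot\rangle$ on $\mathscr{X}$, i.e. $\|x\|^2=\langle x,x\rangle$ for all $x\in\mathscr{X}$. *)

(* Defs.v *)
From mathcomp Require Import all_boot all_order all_algebra.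
From mathcomp Require Import complex.
From mathcomp Require Import reals normedtype exp.

Set Implicit Arguments.
Unset Strict Implicit.
Unset Printing Implicit Defensive.

Import Order.TTheory GRing.Theory Num.Theory.
Import numFieldNormedType.Exports.

Local Open Scope ring_scope.
Local Open Scope complex_scope.

Definition angular_distance (R : realType) (X : normedModType R)
    (p : R) (x y : X) : R :=
  `| (`|x| `^ (1 - p))^-1 *: x - (`|y| `^ (1 - p))^-1 *: y |.

(* In a normed module over R[i] the norm [`|x|] is a nonnegative element of
   R[i]; its real part is the norm as an element of R, to which [powR]
   applies. *)
Definition cnorm (R : realType) (X : normedModType R[i]) (x : X) : R :=
  complex.Re `|x|.

Definition cangular_distance (R : realType) (X : normedModType R[i])
    (p : R) (x y : X) : R :=
  cnorm (((cnorm x `^ (1 - p))^-1)%:C *: x - ((cnorm y `^ (1 - p))^-1)%:C *: y).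

(* Main.v *)
Require Import Defs.
From mathcomp Require Import all_boot all_order all_algebra.
From mathcomp Require Import complex.
From mathcomp Require Import reals normedtype exp.
From mathcomp Require Import ring lra.

(**
  Put a = |x|, b = |y|, u = a^(1-p), v = b^(1-p).  By polarization the square
  of the left-hand side L is an affine function of |x - y|^2,
    L^2 = (a/u)^2 + (b/v)^2 - (a^2 + b^2 - |x - y|^2) / (uv),
  and since 4uv <= (u + v)^2, the excess 4|x - y|^2 - (u + v)^2 L^2 is smallest
  when |x - y| = a + b.  In that extreme case the inequality reads
  (u - v)(a/u - b/v) >= 0, which holds because a/u = a^p and b/v = b^p are
  ordered in the same way as u and v.
*)

Import Order.TTheory GRing.Theory Num.Theory.
Import numFieldNormedType.Exports.

Local Open Scope ring_scope.
Local Open Scope complex_scope.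

(** As [theta] fixes both scalars, the cross terms occur only through the sum [dot x y + dot y x],
    which polarization expresses by [dot (x - y) (x - y)]. Leaving [theta] general serves the real
    and the complex case at once. *)
Lemma dot_scaleB (K : numDomainType) (theta : K -> K) (X : lmodType K)
    (dot : {dot X for theta}) (a b : K) (x y : X) :
  theta a = a -> theta b = b ->
  dot (a *: x - b *: y) (a *: x - b *: y) =
  a ^+ 2 * dot x x + b ^+ 2 * dot y y
    - a * b * (dot x x + dot y y - dot (x - y) (x - y)).
Proof.
move=> ha hb.
rewrite !linearBl !linearBr !linearZl_LR !linearZr_LR /= ha hb.
ring.
Qed.

Lemma norm_scaleB_sqr (K : numDomainType) (theta : K -> K)
    (X : normedModType K) (dot : {dot X for theta})
    (dotE : forall x : X, `|x| ^+ 2 = dot x x) (a b : K) (x y : X) :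
  theta a = a -> theta b = b ->
  `|a *: x - b *: y| ^+ 2 =
  a ^+ 2 * `|x| ^+ 2 + b ^+ 2 * `|y| ^+ 2
    - a * b * (`|x| ^+ 2 + `|y| ^+ 2 - `|x - y| ^+ 2).
Proof. by move=> ha hb; rewrite !dotE; exact: dot_scaleB. Qed.

(** The power-free core: [s] and [t] stand for a/u and b/v, and [D] for |x - y|. *)
Lemma le_div_of_sqr_affine (F : realFieldType) (s t u v D L : F) :
  0 < u -> 0 < v -> 0 <= s -> 0 <= t -> 0 <= D ->
  0 <= (u - v) * (s - t) -> D <= s * u + t * v ->
  L ^+ 2 = s ^+ 2 + t ^+ 2 - ((s * u) ^+ 2 + (t * v) ^+ 2 - D ^+ 2) / (u * v) ->
  L <= 2 * (D / (u + v)).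
Proof.
move=> u0 v0 s0 t0 D0 hst hD hL.
have uv0 : 0 < u * v by rewrite mulr_gt0.
have w0 : 0 < u + v by rewrite addr_gt0.
rewrite mulrA ler_pdivlMr //.
apply: (@le_trans _ _ `|L * (u + v)|); first exact: ler_norm.
rewrite -ler_sqr ?nnegrE ?mulr_ge0 // real_normK ?num_real //.
rewrite exprMn hL -subr_ge0.
have D2 : D ^+ 2 <= (s * u + t * v) ^+ 2.
  by rewrite ler_sqr ?nnegrE ?addr_ge0 ?mulr_ge0 // ltW.
(* The first summand is the value at [D = s * u + t * v], where the excess is a difference of
   squares. The second corrects for smaller [D], with coefficient (u + v)^2/(uv) - 4. *)
have -> : (2 * D) ^+ 2 - (s ^+ 2 + t ^+ 2
      - ((s * u) ^+ 2 + (t * v) ^+ 2 - D ^+ 2) / (u * v)) * (u + v) ^+ 2 =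
    (u - v) * (s - t) * (2 * (s * u + t * v) + (u + v) * (s + t))
    + (u - v) ^+ 2 / (u * v) * ((s * u + t * v) ^+ 2 - D ^+ 2).
  by field; rewrite !gt_eqF.
apply: addr_ge0; apply: mulr_ge0 => //.
- have [u1 v1] := (ltW u0, ltW v0).
  by rewrite !(addr_ge0, mulr_ge0, ler0n).
- by rewrite divr_ge0 ?sqr_ge0 // ltW.
- by rewrite subr_ge0.
Qed.

(** Both powers are nondecreasing, so the two differences never have opposite signs. *)
Lemma powR_comonotone (R : realType) (p q a b : R) :
  0 <= p -> 0 <= q -> 0 <= a -> 0 <= b ->
  0 <= (a `^ p - b `^ p) * (a `^ q - b `^ q).
Proof.
move=> p0 q0 a0 b0; have [ab|/ltW ba] := leP a b.
  by rewrite mulr_le0 // subr_le0 ge0_ler_powR.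
by rewrite mulr_ge0 // subr_ge0 ge0_ler_powR.
Qed.

(** Only real numbers enter here, so that both scalar fields reduce to this bound. *)
Lemma le_div_powR (R : realType) (p a b D L : R) :
  0 <= p <= 1 -> 0 < a -> 0 < b -> 0 <= D -> D <= a + b ->
  L ^+ 2 = (a `^ (1 - p))^-1 ^+ 2 * a ^+ 2 + (b `^ (1 - p))^-1 ^+ 2 * b ^+ 2
    - (a `^ (1 - p))^-1 * (b `^ (1 - p))^-1 * (a ^+ 2 + b ^+ 2 - D ^+ 2) ->
  L <= 2 * (D / (a `^ (1 - p) + b `^ (1 - p))).
Proof.
move=> /andP[p0 p1] a0 b0 D0 hD hL.
have powRK (c : R) : 0 < c -> c `^ p * c `^ (1 - p) = c.
  move=> c0; rewrite -powRD; last by rewrite (gt_eqF c0) implybT.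
  by rewrite addrC subrK powRr1 // ltW.
have u0 := powR_gt0 (1 - p) a0; have v0 := powR_gt0 (1 - p) b0.
apply: (@le_div_of_sqr_affine _ (a `^ p) (b `^ p)) => //.
- exact: powR_ge0.
- exact: powR_ge0.
- by rewrite powR_comonotone ?subr_ge0 // ltW.
- by rewrite !powRK.
have divE (c : R) : 0 < c -> c `^ p = (c `^ (1 - p))^-1 * c.
  move=> c0; rewrite -[X in _ = _ * X](powRK c) // mulrCA mulVf ?mulr1 //.
  by rewrite gt_eqF // powR_gt0.
by rewrite hL !powRK // !divE // !exprMn invfM; ring.
Qed.

Lemma cnormE (R : realType) (X : normedModType R[i]) (x : X) :
  `|x| = (cnorm x)%:C.
Proof. by rewrite /cnorm RRe_real // ger0_real. Qed.

Theorem proposition2p3 (R : realType) :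
  (forall (X : normedModType R) (dot : {dot X for idfun}),
     (forall x : X, `|x| ^+ 2 = dot x x) ->
     forall (p : R) (x y : X), 0 <= p <= 1 -> x != 0 -> y != 0 ->
     angular_distance p x y
       <= 2 * (`|x - y| / (`|x| `^ (1 - p) + `|y| `^ (1 - p))))
  /\
  (forall (X : normedModType R[i]) (dot : {dot X for Num.conj}),
     (forall x : X, `|x| ^+ 2 = dot x x) ->
     forall (p : R) (x y : X), 0 <= p <= 1 -> x != 0 -> y != 0 ->
     cangular_distance p x y
       <= 2 * (cnorm (x - y) / (cnorm x `^ (1 - p) + cnorm y `^ (1 - p)))).
Proof.
split=> X dot dotE p x y p01 x0 y0.
  apply: le_div_powR; rewrite ?normr_gt0 ?ler_normB //.
  exact: (norm_scaleB_sqr _ _ _ dot).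
have cnorm_gt0 (z : X) : z != 0 -> 0 < cnorm z.
  by rewrite -normr_gt0 cnormE ltcR.
apply: le_div_powR; rewrite ?cnorm_gt0 //.
- by rewrite -lecR -cnormE; exact: normr_ge0.
- by rewrite -lecR rmorphD /= -!cnormE ler_normB.
(* The identity for the squared norm is proved in [R[i]], into which [R] embeds injectively. *)
apply: complexI.
have conjR (r : R) : Num.conj r%:C = r%:C.
  by apply: conj_Creal; rewrite complex_real.
rewrite !(rmorphXn, rmorphD, rmorphN, rmorphM) /= -!cnormE.
exact: (norm_scaleB_sqr _ _ _ dot).
Qed.
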